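(* Let $E\to M$ be a vector bundle, $\mathcal E=\mathfrak DE\oplus\mathfrak JE$ its omni-Lie algebroid, and let $(F,\Phi)$ be an automorphism of $\mathcal E$, where $\Phi$ is an automorphism of the vector bundle $E$ and $F:\mathcal E\to\mathcal E$ covers $\Phi$. Then $F$ can be decomposed as the composition of (the automorphism of $\mathcal E$ induced by) the automorphism $\Phi$ of $E$ and a $B$-field transformation: there is $b\in\Gamma(\mathrm{Hom}(\wedge^2\mathfrak DE,E)_{\mathfrak JE})$ with $\mathbf db=0$ such that $F=(\mathrm{Ad}_\Phi+\widetilde\Phi)\circ e^b$.
   Context: **Bundles.** $\mathfrak DE$ is the gauge Lie algebroid of $E$: its sections are the $\mathbb R$-linear $\mathfrak d:\Gamma(E)\to\Gamma(E)$ for which there is a vector field $j(\mathfrak d)$ with $\mathfrak d(fu)=f\mathfrak d(u)+j(\mathfrak d)(f)u$; bracket $[\cdot,\cdot]_{\mathfrak D}$ = commutator, anchor $j$. The first jet bundle $\mathfrak JE$ is regarded as $\{\nu\in\mathrm{Hom}(\mathfrak DE,E):\nu(\Psi)=\Psi(\nu(\mathrm{Id}_E))\ \forall\Psi\in\mathfrak{gl}(E)\}$, the jet $[u]_m$ corresponding to $\mathfrak d\mapsto\mathfrak d(u)(m)$. Write $\langle\mu,\mathfrak d\rangle_E=\langle\mathfrak d,\mu\rangle_E=\mu(\mathfrak d)$, and $\mathbf d:\Gamma(E)\to\Gamma(\mathfrak JE)$, $(\mathbf du)(\mathfrak d)=\mathfrak d(u)$. The Lie derivative on $\Gamma(\mathfrak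 JE)$ is $\langle\mathcal L_{\mathfrak d}\mu,\mathfrak d'\rangle_E=\mathfrak d\langle\mu,\mathfrak d'\rangle_E-\langle\mu,[\mathfrak d,\mathfrak d']_{\mathfrak D}\rangle_E$. **Omni-Lie algebroid.** $\mathcal E=\mathfrak DE\oplus\mathfrak JE$ with anchor $\rho$ the projection to $\mathfrak DE$, pairing $(\mathfrak d+\mu,\mathfrak r+\nu)_E=\tfrac12(\langle\mathfrak d,\nu\rangle_E+\langle\mathfrak r,\mu\rangle_E)$ and bracket $\{\mathfrak d+\mu,\mathfrak r+\nu\}=[\mathfrak d,\mathfrak r]_{\mathfrak D}+\mathcal L_{\mathfrak d}\nu-\mathcal L_{\mathfrak r}\mu+\mathbf d\langle\mu,\mathfrak r\rangle_E$. **Automorphisms.** An automorphism $\Phi:E\to E$ covers a diffeomorphism $\phi:M\to M$; it acts on sections by $\Phi(u)=\Phi\circ u\circ\phi^{-1}$, and induces $\mathrm{Ad}_\Phi(\mathfrak d)(u)=\Phi\circ\mathfrak d\circ\Phi^{-1}(u)$ on $\mathfrak DE$ and $\widetilde\Phi([u]_m)=[\Phi(u)]_{\phi(m)}$ on $\mathfrak JE$. An automorphism of $\mathcal E$ is a pair $(F,\Phi)$, $F:\mathcal E\to\mathcal E$ a bundle automorphism covering a bundle automorphism $\Phi$ of $E$, with $(F(X),F(Y))_E=\Phi(X,Y)_E$, $F\{X,Y\}=\{F(X),F(Y)\}$ and $\rho\circ F=\mathrm{Ad}_\Phi\circ\rho$. **$B$-fields.** $\mathrm{Hom}(\wedge^k\mathfrak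 DE,E)_{\mathfrak JE}$ ($k\ge2$) is the bundle of those $\mu\in\mathrm{Hom}(\wedge^k\mathfrak DE,E)$ for which $\mu(\mathfrak d_1,\dots,\mathfrak d_{k-1},\cdot)\in\mathfrak JE\subset\mathrm{Hom}(\mathfrak DE,E)$ for all $\mathfrak d_i$; $\mathbf d$ also denotes the Chevalley–Eilenberg coboundary of the Lie algebroid $\mathfrak DE$ with coefficients in its tautological representation on $E$. For $b\in\Gamma(\mathrm{Hom}(\wedge^2\mathfrak DE,E)_{\mathfrak JE})$, $e^b(\mathfrak d+\mu)=\mathfrak d+\mu+i_{\mathfrak d}b$; it is called a $B$-field transformation when $\mathbf db=0$. *)

(* Defs.v *)
(* MathComp-Analysis world *)
From HB Require Import structures.
From mathcomp Require Import all_boot all_order all_algebra.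
From mathcomp Require Import all_classical all_reals all_analysis ring.

Set Implicit Arguments.
Unset Strict Implicit.
Unset Printing Implicit Defensive.

Import Order.TTheory GRing.Theory Num.Theory numFieldNormedType.Exports.
Local Open Scope classical_set_scope.
Local Open Scope ring_scope.

(** * Smooth functions on open subsets of R^n *)

Section Euclidean.
Context {R : realType} {n : nat}.
Implicit Types (U V : set 'rV[R]_n) (f g : 'rV[R]_n -> R) (k : nat).

Fixpoint Ck k U f : Prop :=
  (forall x, U x -> {for x, continuous f}) /\
  if k is k'.+1 then
    forall i : 'I_n, (forall x, U x -> derivable f x (delta_mx 0 i)) /\
                     Ck k' U ('D_(delta_mx 0 i) f)
  else True.

Definition smooth U f := forall k, Ck k U f.

Lemma Ck_cont k U f : Ck k U f -> forall x, U x -> {for x, continuous f}.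
Proof. by case: k => [|k] []. Qed.

Lemma CkS k U f : Ck k.+1 U f -> Ck k U f.
Proof.
elim: k f => [|k IH] f [cf h]; first by split.
by split=> // i; have [df hf] := h i; split=> //; exact: IH.
Qed.

Lemma Ck_local k U f :
  (forall x, U x -> exists V, V x /\ Ck k V f) -> Ck k U f.
Proof.
elim: k f => [|k IH] f h.
  split=> // x /h[V [Vx [cf _]]]; exact: cf.
split=> [x /h[V [Vx [cf _]]]|i]; first exact: cf.
split=> [x /h[V [Vx [_ /(_ i)[df _]]]]|]; first exact: df.
by apply: IH => x /h[V [Vx [_ /(_ i)[_ df]]]]; exists V.
Qed.

Lemma Ck_subset k U V f : V `<=` U -> Ck k U f -> Ck k V f.
Proof. by move=> VU hf; apply: Ck_local => x /VU Ux; exists U. Qed.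

Lemma Ck_ext k U f g : open U -> (forall x, U x -> f x = g x) ->
  Ck k U f -> Ck k U g.
Proof.
move=> oU; elim: k f g => [|k IH] f g fg.
all: have nfg x : U x -> \forall y \near x, f y = g y by
  move=> Ux; apply: filterS (open_nbhs_nbhs (conj oU Ux)) => y /fg.
all: have cfg : (forall x, U x -> {for x, continuous f}) ->
  forall x, U x -> {for x, continuous g} by
  move=> cf x Ux; rewrite /prop_for /continuous_at -fg //;
  exact: cvg_trans (near_eq_cvg (nfg _ Ux)) (cf x Ux).
  by move=> [cf _]; split=> //; exact: cfg.
move=> [cf h]; split=> [|i]; first exact: cfg.
have [df hf] := h i; split=> [x Ux|].
  exact: near_eq_derivable (nfg _ Ux) (df _ Ux).
by apply: IH hf => x Ux; exact: near_eq_derive (nfg _ Ux).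
Qed.

Lemma Ck_cst k U (a : R) : open U -> Ck k U (fun=> a).
Proof.
move=> oU; elim: k a => [|k IH] a; split=> //.
1,2: by move=> x _; exact: (@cst_continuous _ _ a x).
move=> i; split=> [x _|]; first exact: derivable_cst.
by apply: Ck_ext oU _ (IH 0) => x _; rewrite derive_cst.
Qed.

Lemma CkD k U f g : open U -> Ck k U f -> Ck k U g -> Ck k U (f + g).
Proof.
move=> oU; elim: k f g => [|k IH] f g [cf hf] [cg hg].
all: split=> //.
1,2: by move=> x Ux; exact: continuousD (cf _ Ux) (cg _ Ux).
move=> i; have [df Hf] := hf i; have [dg Hg] := hg i; split=> [x Ux|].
  by apply: derivableD; [exact: df|exact: dg].
by apply: Ck_ext oU _ (IH _ _ Hf Hg) => x Ux; rewrite deriveD //; [exact: df|exact: dg].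
Qed.

Lemma CkM k U f g : open U -> Ck k U f -> Ck k U g -> Ck k U (f * g).
Proof.
move=> oU; elim: k f g => [|k IH] f g Cf Cg; have [cf hf] := Cf; have [cg hg] := Cg.
all: split=> //.
1,2: by move=> x Ux; exact: continuousM (cf _ Ux) (cg _ Ux).
move=> i; have [df Hf] := hf i; have [dg Hg] := hg i; split=> [x Ux|].
  by apply: derivableM; [exact: df|exact: dg].
have := CkD oU (IH _ _ (CkS Cf) Hg) (IH _ _ (CkS Cg) Hf).
by apply: Ck_ext oU _ => x Ux; rewrite deriveM //; [exact: df|exact: dg].
Qed.

End Euclidean.

(** * Smooth manifolds *)

Structure manifold (R : realType) (n : nat) := Manifold {
  mcar :> topologicalType;
  _ : hausdorff_space mcar;
  _ : @second_countable mcar;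
  chart : Type;
  cdom : chart -> set mcar;
  ccod : chart -> set 'rV[R]_n;
  coord : chart -> mcar -> 'rV[R]_n;
  param : chart -> 'rV[R]_n -> mcar;
  cdom_open : forall c, open (cdom c);
  ccod_open : forall c, open (ccod c);
  cdom_cover : forall m, exists c, cdom c m;
  coord_sub : forall c m, cdom c m -> ccod c (coord c m);
  param_sub : forall c x, ccod c x -> cdom c (param c x);
  coordK : forall c m, cdom c m -> param c (coord c m) = m;
  paramK : forall c x, ccod c x -> coord c (param c x) = x;
  coord_cont : forall c m, cdom c m -> {for m, continuous (coord c)};
  param_cont : forall c x, ccod c x -> {for x, continuous (param c)};
  chart_smooth : forall c d (k : 'I_n),
    smooth (ccod c `&` param c @^-1` cdom d) (fun x => coord d (param c x) 0 k)
}.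

Section SmoothFunctions.
Context {R : realType} {n : nat} {M : manifold R n}.
Implicit Types (U V : set M) (f g : M -> R).

Definition smooth_on U f :=
  forall c : chart M, smooth (ccod c `&` param c @^-1` U) (f \o param c).

Lemma param_open (c : chart M) U :
  open U -> open (ccod c `&` param c @^-1` U).
Proof.
move=> oU; rewrite openE => x [cx Ux]; rewrite /interior.
apply: filterI; first exact: open_nbhs_nbhs (conj (@ccod_open _ _ M c) cx).
by apply: (param_cont cx); exact: open_nbhs_nbhs.
Qed.

Lemma smooth_on_ext U f g : open U -> (forall m, U m -> f m = g m) ->
  smooth_on U f -> smooth_on U g.
Proof.
move=> oU fg hf c k; apply: Ck_ext (param_open oU) _ (hf c k).
by move=> x [_ Ux]; exact: fg.
Qed.

Lemma smooth_on_local U f :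
  (forall m, U m -> exists V, V m /\ smooth_on V f) -> smooth_on U f.
Proof.
move=> h c k; apply: Ck_local => x [cx Ux]; have [V [Vx hf]] := h _ Ux.
by exists (ccod c `&` param c @^-1` V); split=> //; exact: hf.
Qed.

Lemma smooth_on_subset U V f : V `<=` U -> smooth_on U f -> smooth_on V f.
Proof. by move=> VU hf; apply: smooth_on_local => m /VU Um; exists U. Qed.

Lemma smooth_on_cst U (a : R) : open U -> smooth_on U (fun=> a).
Proof. by move=> oU c k; exact: Ck_cst (param_open oU). Qed.

Lemma smooth_onD U f g : open U ->
  smooth_on U f -> smooth_on U g -> smooth_on U (fun m => f m + g m).
Proof. by move=> oU hf hg c k; exact: CkD (param_open oU) (hf c k) (hg c k). Qed.

Lemma smooth_onM U f g : open U ->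
  smooth_on U f -> smooth_on U g -> smooth_on U (fun m => f m * g m).
Proof. by move=> oU hf hg c k; exact: CkM (param_open oU) (hf c k) (hg c k). Qed.

Lemma smooth_on_sum (I : Type) (s : seq I) U (F : I -> M -> R) : open U ->
  (forall i, smooth_on U (F i)) -> smooth_on U (fun m => \sum_(i <- s) F i m).
Proof.
move=> oU hF; elim: s => [|i s IH].
  apply: smooth_on_ext oU _ (smooth_on_cst 0 oU) => m _; by rewrite big_nil.
by apply: smooth_on_ext oU _ (smooth_onD oU (hF i) IH) => m _; rewrite big_cons.
Qed.

Definition smooth_map (phi : M -> M) :=
  continuous phi /\
  forall V f, open V -> smooth_on V f -> smooth_on (phi @^-1` V) (f \o phi).

End SmoothFunctions.

Record diffeo {R : realType} {n : nat} (M : manifold R n) := Diffeo {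
  dmap :> M -> M;
  dmapV : M -> M;
  dmapK : cancel dmap dmapV;
  dmapVK : cancel dmapV dmap;
  dmap_smooth : smooth_map dmap;
  dmapV_smooth : smooth_map dmapV
}.

Section SmoothRing.
Context {R : realType} {n : nat} (M : manifold R n).

Definition smooth_pred : {pred M -> R} := fun f => `[< smooth_on setT f >].

Record smfun := SmFun { smval :> M -> R; _ : smval \in smooth_pred }.
HB.instance Definition _ := [isSub for smval].
HB.instance Definition _ := [Choice of smfun by <:].

Lemma smooth_predP f : reflect (smooth_on setT f) (f \in smooth_pred).
Proof. exact: asboolP. Qed.

Lemma smfunP (f : smfun) : smooth_on setT f.
Proof. exact/smooth_predP/(valP f). Qed.

Fact smooth_subring : subring_closed smooth_pred.
Proof.
split=> [|f g /smooth_predP hf /smooth_predP hg|f g /smooth_predP hf /smooth_predP hg].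
- by apply/smooth_predP; exact: smooth_on_cst openT.
- apply/smooth_predP; apply: smooth_onD openT hf _.
  have := smooth_onM openT (smooth_on_cst (-1) openT) hg.
  by apply: smooth_on_ext openT _ => m _; rewrite mulN1r.
- by apply/smooth_predP; exact: smooth_onM openT hf hg.
Qed.

Fact smooth_submod : subsemimod_closed smooth_pred.
Proof.
have [h1 hB hM] := smooth_subring.
have h0 : 0 \in smooth_pred by rewrite -(subrr 1) hB.
split; first split=> // f g hf hg.
  by rewrite -[g]opprK hB // -sub0r hB.
move=> a f /smooth_predP hf; apply/smooth_predP.
exact: smooth_onM openT (smooth_on_cst a openT) hf.
Qed.

HB.instance Definition _ :=
  GRing.SubChoice_isSubComPzRing.Build (M -> R) smooth_pred smfun smooth_subring.
HB.instance Definition _ :=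
  GRing.SubZmodule_isSubLmodule.Build R (M -> R) smooth_pred smfun smooth_submod.

Lemma smfun_ext (f g : smfun) : f =1 g -> f = g.
Proof. by move=> fg; apply: val_inj; apply/funext. Qed.

End SmoothRing.

(** * Vector bundles and their sections *)

(* Given by the fibres and a smooth trivializing cocycle; the rank is only
   required to be locally constant.  [tmap t m] is only relevant for m in
   [tdom t].  *)
Structure vbundle {R : realType} {n : nat} (M : manifold R n) := VBundle {
  fib :> M -> lmodType R;
  triv : Type;
  trank : triv -> nat;
  tdom : triv -> set M;
  tmap : forall t m, {linear fib m -> 'rV[R]_(trank t)};
  tinv : forall t m, 'rV[R]_(trank t) -> fib m;
  tdom_open : forall t, open (tdom t);
  tdom_cover : forall m, exists t, tdom t m;
  tmapK : forall t m, tdom t m -> cancel (tmap t m) (@tinv t m);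
  tinvK : forall t m, tdom t m -> cancel (@tinv t m) (tmap t m);
  triv_smooth : forall s t (k : 'I_(trank s)) (l : 'I_(trank t)),
    smooth_on (tdom s `&` tdom t)
      (fun m => tmap t m (@tinv s m (delta_mx 0 k)) 0 l)
}.

Arguments tdom {R n M} v t.
Arguments tinv {R n M v} t m _.
Arguments tdom_open {R n M} v t.

Section Sections.
Context {R : realType} {n : nat} {M : manifold R n} (E : vbundle M).

(* all set-theoretic sections of E *)
Definition dsec := forall m, E m.

HB.instance Definition _ := gen_eqMixin dsec.
HB.instance Definition _ := gen_choiceMixin dsec.

Lemma dsec_ext (u v : dsec) : (forall m, u m = v m) -> u = v.
Proof. exact: functional_extensionality_dep. Qed.

Fact dsec_addA : associative (fun (u v : dsec) m => u m + v m).
Proof. by move=> u v w; apply: dsec_ext => m; exact: addrA. Qed.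
Fact dsec_addC : commutative (fun (u v : dsec) m => u m + v m).
Proof. by move=> u v; apply: dsec_ext => m; exact: addrC. Qed.
Fact dsec_add0 : left_id (fun m => 0) (fun (u v : dsec) m => u m + v m).
Proof. by move=> u; apply: dsec_ext => m; exact: add0r. Qed.
Fact dsec_addN :
  left_inverse (fun m => 0) (fun (u : dsec) m => - u m) (fun (u v : dsec) m => u m + v m).
Proof. by move=> u; apply: dsec_ext => m; exact: addNr. Qed.
HB.instance Definition _ :=
  GRing.isZmodule.Build dsec dsec_addA dsec_addC dsec_add0 dsec_addN.

Definition dsec_scale (a : R) (u : dsec) : dsec := fun m => a *: u m.
Fact dsec_scaleA a b u : dsec_scale a (dsec_scale b u) = dsec_scale (a * b) u.
Proof. by apply: dsec_ext => m; exact: scalerA. Qed.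
Fact dsec_scale1 : left_id 1 dsec_scale.
Proof. by move=> u; apply: dsec_ext => m; exact: scale1r. Qed.
Fact dsec_scaleDr : right_distributive dsec_scale +%R.
Proof. by move=> a u v; apply: dsec_ext => m; exact: scalerDr. Qed.
Fact dsec_scaleDl u : {morph dsec_scale^~ u : a b / a + b}.
Proof. by move=> a b; apply: dsec_ext => m; exact: scalerDl. Qed.
HB.instance Definition _ := GRing.Zmodule_isLmodule.Build R dsec
  dsec_scaleA dsec_scale1 dsec_scaleDr dsec_scaleDl.

Definition is_section (u : dsec) := forall t (k : 'I_(trank t)),
  smooth_on (tdom E t) (fun m => tmap t m (u m) 0 k).

Definition section_pred : {pred dsec} := fun u => `[< is_section u >].

Record Gam := Sec { secval : dsec; _ : secval \in section_pred }.
HB.instance Definition _ := [isSub for secval].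
HB.instance Definition _ := [Choice of Gam by <:].

Definition sec_app (u : Gam) m : E m := secval u m.
Coercion sec_app : Gam >-> Funclass.

Lemma GamP (u : Gam) : is_section (secval u).
Proof. exact/asboolP/(valP u). Qed.

Definition mkGam (u : dsec) (hu : is_section u) : Gam := Sec (introT (asboolP _) hu).

Lemma Gam_ext (u v : Gam) : (forall m, u m = v m) -> u = v.
Proof. by move=> uv; apply: val_inj; exact: dsec_ext. Qed.

Lemma sectionM (f : smfun M) u : is_section u -> is_section (fun m => f m *: u m).
Proof.
move=> hu t k; have of_ := smooth_on_subset (@subsetT _ _) (smfunP f).
apply: smooth_on_ext (tdom_open E t) _
  (smooth_onM (tdom_open E t) (of_ _) (hu t k)) => m _.
by rewrite linearZ mxE.
Qed.

Fact section_submod : subsemimod_closed section_pred.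
Proof.
split; last first.
  move=> a u /asboolP hu; apply/asboolP => t k.
  have oT := tdom_open E t.
  apply: smooth_on_ext oT _ (smooth_onM oT (smooth_on_cst a oT) (hu t k)) => m _.
  by rewrite linearZ mxE.
split.
  apply/asboolP => t k; have oT := tdom_open E t.
  apply: smooth_on_ext oT _ (smooth_on_cst 0 oT) => m _.
  by rewrite linear0 mxE.
move=> u v /asboolP hu /asboolP hv; apply/asboolP => t k.
have oT := tdom_open E t.
apply: smooth_on_ext oT _ (smooth_onD oT (hu t k) (hv t k)) => m _.
by rewrite linearD mxE.
Qed.

HB.instance Definition _ :=
  GRing.SubChoice_isSubLmodule.Build R dsec section_pred Gam section_submod.

Definition secM (f : smfun M) (u : Gam) : Gam := mkGam (sectionM f (GamP u)).

End Sections.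
Notation "f ** u" := (secM f u) (at level 40, left associativity).

(** * The gauge Lie algebroid *)

Section Gauge.
Context {R : realType} {n : nat} {M : manifold R n} (E : vbundle M).

Definition is_tangent (m : M) (X : smfun M -> R) :=
  scalar X /\ forall f g, X (f * g) = f m * X g + X f * g m.

Definition is_vector_field (X : smfun M -> smfun M) :=
  linear X /\ forall f g, X (f * g) = f * X g + X f * g.

Definition gauge_pred m : {pred Gam E -> E m} := fun d =>
  `[< linear d /\ exists2 X, is_tangent m X &
        forall f u, d (f ** u) = f m *: d u + X f *: u m >].
Arguments gauge_pred : clear implicits.

(* the fibre of the gauge Lie algebroid at m *)
Record DE m := Gauge { gfun :> Gam E -> E m; _ : gfun \in gauge_pred m }.
HB.instance Definition _ m := [isSub for @gfun m].
HB.instance Definition _ m := [Choice of DE m by <:].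

Fact gauge_submod m : subsemimod_closed (gauge_pred m).
Proof.
split; last first.
  move=> a d /asboolP[ld [X [lX dX] hd]]; apply/asboolP.
  have ad u : (a *: d) u = a *: d u by [].
  split; first by move=> b u v; rewrite !ad ld scalerDr !scalerA mulrC.
  exists (fun f => a * X f); first split.
  - by move=> b f g; rewrite lX; ring.
  - by move=> f g; rewrite dX; ring.
  - by move=> f u; rewrite !ad hd scalerDr !scalerA (mulrC a).
split.
  apply/asboolP; split; first by move=> a u v; rewrite scaler0 addr0.
  exists (fun=> 0); first split.
  - by move=> a f g; rewrite mulr0 addr0.
  - by move=> f g; rewrite mulr0 mul0r addr0.
  - by move=> f u; rewrite scaler0 scale0r addr0.
move=> d e /asboolP[ld [X [lX dX] hd]] /asboolP[le [Y [lY dY] he]].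
apply/asboolP; have de u : (d + e) u = d u + e u by [].
split; first by move=> a u v; rewrite !de ld le scalerDr addrACA.
exists (fun f => X f + Y f); first split.
- by move=> a f g; rewrite lX lY; ring.
- by move=> f g; rewrite dX dY; ring.
- by move=> f u; rewrite !de hd he scalerDr scalerDl addrACA.
Qed.

HB.instance Definition _ m :=
  GRing.SubChoice_isSubLmodule.Build R (Gam E -> E m) (gauge_pred m) (DE m)
    (gauge_submod m).

Lemma gaugeP m (d : DE m) : linear d /\ exists2 X, is_tangent m X &
  forall f u, d (f ** u) = f m *: d u + X f *: u m.
Proof. exact/asboolP/(valP d). Qed.

Lemma DE_ext m (d e : DE m) : (forall u, d u = e u) -> d = e.
Proof. by move=> de; apply: val_inj; apply/funext. Qed.

Definition mkDE m (d : Gam E -> E m) (ld : linear d)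
    (hd : exists2 X, is_tangent m X & forall f u, d (f ** u) = f m *: d u + X f *: u m) :
  DE m := Gauge (introT (asboolP _) (conj ld hd)).

(* sections of the gauge Lie algebroid, with anchor X *)
Record GDE := GSec {
  gop :> Gam E -> Gam E;
  gop_linear : linear gop;
  gop_der : exists2 X, is_vector_field X &
    forall f u, gop (f ** u) = f ** gop u + X f ** u
}.

Fact gval_linear (D : GDE) m : linear (fun u => D u m).
Proof. by move=> a u v; rewrite gop_linear. Qed.

Fact gval_der (D : GDE) m : exists2 X, is_tangent m X &
  forall f u, D (f ** u) m = f m *: D u m + X f *: u m.
Proof.
have [X [lX dX] hX] := gop_der D; exists (fun f => X f m).
  by split=> [a f g|f g]; rewrite ?lX ?dX.
by move=> f u; rewrite hX.
Qed.

Definition gval (D : GDE) m : DE m := mkDE (gval_linear D m) (gval_der D m).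

Definition gbr_fun (D D' : GDE) u := D (D' u) - D' (D u).

Fact gbr_linear D D' : linear (gbr_fun D D').
Proof.
move=> a u v; rewrite /gbr_fun !gop_linear scalerBr.
by rewrite opprD addrACA.
Qed.

Lemma secDr (f : smfun M) (u v : Gam E) : f ** (u + v) = f ** u + f ** v.
Proof. by apply: Gam_ext => m; exact: scalerDr. Qed.
Lemma secDl (f g : smfun M) (u : Gam E) : (f + g) ** u = f ** u + g ** u.
Proof. by apply: Gam_ext => m; exact: scalerDl. Qed.
Lemma secNl (f : smfun M) (u : Gam E) : (- f) ** u = - (f ** u).
Proof. by apply: Gam_ext => m; exact: scaleNr. Qed.
Lemma secNr (f : smfun M) (u : Gam E) : f ** (- u) = - (f ** u).
Proof. by apply: Gam_ext => m; exact: scalerN. Qed.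

Lemma gopD (D : GDE) u v : D (u + v) = D u + D v.
Proof. by have := gop_linear D 1 u v; rewrite !scale1r. Qed.

Fact addrB_cross (V : zmodType) (a b c d e g : V) :
  a + b + (c + d) - (e + c + (b + g)) = a - e + (d - g).
Proof.
rewrite [c + d]addrC addrACA [b + g]addrC [e + c + _]addrACA [c + b]addrC.
by rewrite opprD [LHS]addrACA subrr addr0 opprD [LHS]addrACA.
Qed.

Fact gbr_der D D' : exists2 X, is_vector_field X &
  forall f u, gbr_fun D D' (f ** u) = f ** gbr_fun D D' u + X f ** u.
Proof.
have [X [lX dX] hX] := gop_der D; have [Y [lY dY] hY] := gop_der D'.
have addX f g : X (f + g) = X f + X g by have := lX 1 f g; rewrite !scale1r.
have addY f g : Y (f + g) = Y f + Y g by have := lY 1 f g; rewrite !scale1r.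
exists (fun f => X (Y f) - Y (X f)).
  split=> [a f g|f g].
    by rewrite lY lX lX lY scalerBr opprD addrACA.
  by rewrite dY dX addX addY !dX !dY; ring.
move=> f u; rewrite /gbr_fun hY hX !gopD !hX !hY secDr secNr secDl secNl.
exact: addrB_cross.
Qed.

Definition gbracket (D D' : GDE) : GDE := GSec (gbr_linear D D') (gbr_der D D').

(* gl(E_m) inside the fibre of the gauge Lie algebroid *)
Fact gl_linear m (Psi : {linear E m -> E m}) : linear (fun u : Gam E => Psi (u m)).
Proof. by move=> a u v; rewrite -linearP. Qed.

Fact gl_der m (Psi : {linear E m -> E m}) : exists2 X, is_tangent m X &
  forall f (u : Gam E), Psi ((f ** u) m) = f m *: Psi (u m) + X f *: u m.
Proof.
exists (fun=> 0).
  by split=> [a f g|f g]; rewrite ?mulr0 ?mul0r ?addr0.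
by move=> f u; rewrite scale0r addr0 -linearZ.
Qed.

Definition gl m (Psi : {linear E m -> E m}) : DE m := mkDE (gl_linear Psi) (gl_der Psi).

End Gauge.

(** * The first jet bundle *)

Section Jets.
Context {R : realType} {n : nat} {M : manifold R n} (E : vbundle M).

Definition jet_pred m : {pred DE E m -> E m} := fun nu =>
  `[< linear nu /\ forall Psi : {linear E m -> E m}, nu (gl Psi) = Psi (nu (gl idfun)) >].

(* the fibre of the first jet bundle at m *)
Record JE m := Jet { jfun :> DE E m -> E m; _ : jfun \in @jet_pred m }.
HB.instance Definition _ m := [isSub for @jfun m].
HB.instance Definition _ m := [Choice of JE m by <:].

Fact jet_submod m : subsemimod_closed (@jet_pred m).
Proof.
split; last first.
  move=> a nu /asboolP[lnu hnu]; apply/asboolP.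
  have anu d : (a *: nu) d = a *: nu d by [].
  split; first by move=> b d e; rewrite !anu lnu scalerDr !scalerA mulrC.
  by move=> Psi; rewrite !anu hnu linearZ.
split.
  apply/asboolP; split; first by move=> a u v; rewrite scaler0 addr0.
  by move=> Psi; rewrite /= linear0.
move=> mu nu /asboolP[lmu hmu] /asboolP[lnu hnu]; apply/asboolP.
have mnu d : (mu + nu) d = mu d + nu d by [].
split; first by move=> a d e; rewrite !mnu lmu lnu scalerDr addrACA.
by move=> Psi; rewrite !mnu hmu hnu linearD.
Qed.

HB.instance Definition _ m :=
  GRing.SubChoice_isSubLmodule.Build R (DE E m -> E m) (@jet_pred m) (JE m)
    (@jet_submod m).

Lemma jetP m (nu : JE m) : linear nu /\
  forall Psi : {linear E m -> E m}, nu (gl Psi) = Psi (nu (gl idfun)).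
Proof. exact/asboolP/(valP nu). Qed.

Lemma JE_ext m (mu nu : JE m) : (forall d, mu d = nu d) -> mu = nu.
Proof. by move=> mn; apply: val_inj; apply/funext. Qed.

Definition mkJE m (nu : DE E m -> E m) (lnu : linear nu)
  (hnu : forall Psi : {linear E m -> E m}, nu (gl Psi) = Psi (nu (gl idfun))) : JE m :=
  Jet (introT (asboolP _) (conj lnu hnu)).

(* the jet [u]_m *)
Fact jet_linear m (u : Gam E) : linear (fun d : DE E m => d u).
Proof. by []. Qed.
Fact jet_gl m (u : Gam E) (Psi : {linear E m -> E m}) :
  (gl Psi : DE E m) u = Psi ((gl idfun : DE E m) u).
Proof. by []. Qed.
Definition jet m (u : Gam E) : JE m := mkJE (jet_linear u) (jet_gl u).

(* sections of the first jet bundle *)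
Record GJE := JSec {
  jval :> forall m, JE m;
  jval_smooth : forall D : GDE E, is_section (fun m => jval m (gval D m))
}.

Definition jpair (mu : GJE) (D : GDE E) : Gam E := mkGam (jval_smooth mu D).

Fact jd_smooth (u : Gam E) (D : GDE E) : is_section (fun m => jet m u (gval D m)).
Proof. exact: GamP (D u). Qed.
Definition jd (u : Gam E) : GJE := JSec (jd_smooth u).

(* the pairing of the Lie derivative of mu along D with D' *)
Definition lie_pair (D : GDE E) (mu : GJE) (D' : GDE E) : Gam E :=
  D (jpair mu D') - jpair mu (gbracket D D').

(** * The omni-Lie algebroid *)

Definition omni m : Type := (DE E m * JE m)%type.

Definition opair m (X Y : omni m) : E m := 2^-1 *: (Y.2 X.1 + X.2 Y.1).

Definition Gomni : Type := (GDE E * GJE)%type.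
Definition oval (X : Gomni) m : omni m := (gval X.1 m, X.2 m).

(* Z = {X, Y}.  As in the definition of the Lie derivative, the component of
   the bracket in Gamma(JE) is specified by its pairings with the sections of
   DE: it exists (tensoriality in D') and is unique (every element of a fibre
   of DE is the value of a section). *)
Definition is_obracket (X Y Z : Gomni) :=
  Z.1 = gbracket X.1 Y.1 /\
  forall D' : GDE E, jpair Z.2 D' =
    lie_pair X.1 Y.2 D' - lie_pair Y.1 X.2 D' + jpair (jd (jpair X.2 Y.1)) D'.

(** * B-fields *)

Record bform := BForm {
  bfun :> forall m, DE E m -> DE E m -> E m;
  bfun_linear : forall m e, linear (fun d => @bfun m d e);
  bfun_alt : forall m d, @bfun m d d = 0;
  bfun_jet : forall m d, @bfun m d \in @jet_pred m;
  bfun_smooth : forall D D' : GDE E, is_section (fun m => bfun (gval D m) (gval D' m))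
}.

Definition bcontr (b : bform) m (d : DE E m) : JE m := Jet (bfun_jet b d).
Definition bsec (b : bform) (D D' : GDE E) : Gam E := mkGam (bfun_smooth b D D').

(* the Chevalley-Eilenberg coboundary of a 2-cochain *)
Definition bd (b : bform) (D1 D2 D3 : GDE E) : Gam E :=
    D1 (bsec b D2 D3) - D2 (bsec b D1 D3) + D3 (bsec b D1 D2)
  - bsec b (gbracket D1 D2) D3 + bsec b (gbracket D1 D3) D2
  - bsec b (gbracket D2 D3) D1.
Definition bclosed (b : bform) := forall D1 D2 D3, bd b D1 D2 D3 = 0.

Definition expb (b : bform) m (X : omni m) : omni m := (X.1, X.2 + bcontr b X.1).

End Jets.

(** * Automorphisms of the bundle *)

Record vbaut {R : realType} {n : nat} {M : manifold R n} (E : vbundle M) := VBAut {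
  base : diffeo M;
  vfib :> forall m, {linear E m -> E (base m)};
  vinv : forall m, {linear E (base m) -> E m};
  vfibK : forall m, cancel (vfib m) (vinv m);
  vinvK : forall m, cancel (vinv m) (vfib m);
  vfib_smooth : forall s t (k : 'I_(trank s)) (l : 'I_(trank t)),
    smooth_on (tdom E s `&` base @^-1` tdom E t)
      (fun m => tmap t (base m) (vfib m (tinv s m (delta_mx 0 k))) 0 l);
  vinv_smooth : forall s t (k : 'I_(trank s)) (l : 'I_(trank t)),
    smooth_on (tdom E s `&` base @^-1` tdom E t)
      (fun m => tmap s m (vinv m (tinv t (base m) (delta_mx 0 l))) 0 k)
}.

Section Automorphisms.
Context {R : realType} {n : nat} {M : manifold R n} {E : vbundle M} (Phi : vbaut E).
Local Notation phi := (base Phi).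

(* Phi(u) = Phi o u o phi^-1, transported along phi (phi^-1 x) = x *)
Definition vpush_fun (u : Gam E) : dsec E :=
  fun x => eq_rect _ (fun y : M => E y) (Phi (dmapV phi x) (u (dmapV phi x))) x (dmapVK phi x).

Definition vpull_fun (u : Gam E) : dsec E := fun m => vinv Phi m (u (phi m)).

Lemma eq_rect_tmap t x y (e : x = y) (v : E x) (k : 'I_(trank t)) :
  tmap t y (eq_rect x (fun z : M => E z) v y e) 0 k = tmap t x v 0 k.
Proof. by case: y / e. Qed.

Lemma tmap_expand t m (v : E m) : tdom E t m ->
  v = \sum_l tmap t m v 0 l *: tinv t m (delta_mx 0 l).
Proof.
move=> tm; apply: (can_inj (tmapK tm)); rewrite linear_sum /=.
rewrite [LHS]row_sum_delta; apply: eq_bigr => l _.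
by rewrite linearZ /= (tinvK tm).
Qed.

Lemma open_base t : open (phi @^-1` tdom E t).
Proof.
have [/continuousP cphi _] := dmap_smooth phi; apply: cphi; exact: tdom_open.
Qed.

Fact vpull_smooth u : is_section (vpull_fun u).
Proof.
move=> s k; apply: smooth_on_local => m sm.
have [t tm] := tdom_cover E (phi m).
exists (tdom E s `&` phi @^-1` tdom E t); split=> //.
have oV : open (tdom E s `&` phi @^-1` tdom E t).
  by apply: openI; [exact: tdom_open|exact: open_base].
have xs l := (dmap_smooth phi).2 _ _ (tdom_open E t) (GamP u l).
have := smooth_on_sum (index_enum _) oV (fun l => smooth_onM oV
  (smooth_on_subset (@subIsetr _ _ _) (xs l)) (vinv_smooth Phi k l)).
apply: smooth_on_ext oV _ => x [sx tx].
rewrite /vpull_fun [in RHS](tmap_expand (u (phi x)) tx) !linear_sum summxE.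
by apply: eq_bigr => l _; rewrite !linearZ mxE.
Qed.

Fact vpush_smooth u : is_section (vpush_fun u).
Proof.
move=> t l; apply: smooth_on_local => x tx.
have [s sx] := tdom_cover E (dmapV phi x).
pose W : set M := tdom E s `&` phi @^-1` tdom E t.
have oW : open W by apply: openI; [exact: tdom_open|exact: open_base].
exists (dmapV phi @^-1` W); split; first by split=> //=; rewrite dmapVK.
pose G m := tmap t (phi m) (Phi m (u m)) 0 l.
have hG : smooth_on W G.
  have := smooth_on_sum (index_enum _) oW (fun k => smooth_onM oW
    (smooth_on_subset (@subIsetl _ _ _) (GamP u k)) (vfib_smooth Phi k l)).
  apply: smooth_on_ext oW _ => m [sm tm].
  rewrite /G [in RHS](tmap_expand (u m) sm) !linear_sum summxE.
  by apply: eq_bigr => k _; rewrite !linearZ mxE.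
have [/continuousP/(_ _ oW) oV /(_ _ _ oW hG)] := dmapV_smooth phi.
by apply: smooth_on_ext oV _ => y _; rewrite /vpush_fun eq_rect_tmap.
Qed.

Definition vpush u : Gam E := mkGam (vpush_smooth u).
Definition vpull u : Gam E := mkGam (vpull_smooth u).

Lemma vpushE u m : vpush u (phi m) = Phi m (u m).
Proof.
rewrite /vpush /sec_app /= /vpush_fun; move: (dmapVK phi (phi m)).
by rewrite (dmapK phi m) => e; rewrite (Prop_irrelevance e erefl).
Qed.

Lemma vpull_vpush u : vpull (vpush u) = u.
Proof.
by apply: Gam_ext => m; rewrite /vpull /sec_app /= /vpull_fun vpushE vfibK.
Qed.

Lemma phi_surj (P : M -> Prop) : (forall m, P (phi m)) -> forall x, P x.
Proof. by move=> h x; rewrite -(dmapVK phi x). Qed.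

Lemma vpush_vpull u : vpush (vpull u) = u.
Proof. by apply: Gam_ext; apply: phi_surj => m; rewrite vpushE vinvK. Qed.

Fact smpull_smooth (f : smfun M) : f \o phi \in @smooth_pred R n M.
Proof.
apply/smooth_predP; have [_ /(_ setT f openT (smfunP f))] := dmap_smooth phi.
by rewrite preimage_setT.
Qed.
Definition smpull f : smfun M := SmFun (smpull_smooth f).

Fact smpush_smooth (f : smfun M) : f \o dmapV phi \in @smooth_pred R n M.
Proof.
apply/smooth_predP; have [_ /(_ setT f openT (smfunP f))] := dmapV_smooth phi.
by rewrite preimage_setT.
Qed.
Definition smpush f : smfun M := SmFun (smpush_smooth f).

Fact vpull_linear : linear vpull.
Proof. by move=> a u v; apply: Gam_ext => m; exact: linearP. Qed.

Fact vpush_linear : linear vpush.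
Proof.
move=> a u v; apply: Gam_ext; apply: phi_surj => m.
by rewrite -[RHS]/(a *: vpush u (phi m) + vpush v (phi m)) !vpushE -linearP.
Qed.

Lemma vpullM f u : vpull (f ** u) = smpull f ** vpull u.
Proof. by apply: Gam_ext => m; exact: linearZ. Qed.

Lemma vpushM f u : vpush (f ** u) = smpush f ** vpush u.
Proof.
apply: Gam_ext; apply: phi_surj => m.
rewrite -[RHS]/(f (dmapV phi (phi m)) *: vpush u (phi m)) dmapK !vpushE.
by rewrite -linearZ.
Qed.

(* Ad_Phi and its inverse on the fibres of the gauge Lie algebroid *)
Fact Ad_linear m (d : DE E m) : linear (fun u => Phi m (d (vpull u))).
Proof. by move=> a u v; rewrite vpull_linear (gaugeP d).1 linearP. Qed.

Fact Ad_der m (d : DE E m) : exists2 X, is_tangent (phi m) X & forall f u,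
  Phi m (d (vpull (f ** u))) = f (phi m) *: Phi m (d (vpull u)) + X f *: u (phi m).
Proof.
have [_ [X [lX dX] hX]] := gaugeP d; exists (X \o smpull); first split.
- by move=> a f g /=; rewrite -lX; congr X; apply: smfun_ext.
- move=> f g /=; rewrite -[f (phi m)]/(smpull f m) -[g (phi m)]/(smpull g m) -dX.
  by congr X; apply: smfun_ext.
- by move=> f u; rewrite vpullM hX linearP linearZ vinvK.
Qed.

Definition Ad m (d : DE E m) : DE E (phi m) := mkDE (Ad_linear d) (Ad_der d).

Fact Adinv_linear m (d : DE E (phi m)) : linear (fun u => vinv Phi m (d (vpush u))).
Proof. by move=> a u v; rewrite vpush_linear (gaugeP d).1 linearP. Qed.

Fact Adinv_der m (d : DE E (phi m)) : exists2 X, is_tangent m X & forall f u,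
  vinv Phi m (d (vpush (f ** u))) = f m *: vinv Phi m (d (vpush u)) + X f *: u m.
Proof.
have [_ [X [lX dX] hX]] := gaugeP d; exists (X \o smpush); first split.
- by move=> a f g /=; rewrite -lX; congr X; apply: smfun_ext.
- have fm (h : smfun M) : h m = smpush h (phi m) by rewrite /= dmapK.
  by move=> f g /=; rewrite !fm -dX; congr X; apply: smfun_ext.
- move=> f u; rewrite vpushM hX linearP linearZ vpushE vfibK.
  by rewrite -[smpush f _]/(f _) dmapK.
Qed.

Definition Adinv m (d : DE E (phi m)) : DE E m := mkDE (Adinv_linear d) (Adinv_der d).

Lemma AdK m : cancel (@Ad m) (@Adinv m).
Proof. by move=> d; apply: DE_ext => u /=; rewrite vfibK vpull_vpush. Qed.

Lemma AdinvK m : cancel (@Adinv m) (@Ad m).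
Proof. by move=> d; apply: DE_ext => u /=; rewrite vinvK vpush_vpull. Qed.

(* the map [u]_m |-> [Phi(u)]_(phi m), see [jet_mapE] *)
Fact jet_map_linear m (nu : JE E m) : linear (fun d => Phi m (nu (Adinv d))).
Proof.
move=> a d e; rewrite -linearP -(jetP nu).1; congr (Phi m (nu _)).
by apply: DE_ext => u; rewrite -[LHS]/(vinv Phi m (a *: d _ + e _)) linearP.
Qed.

Fact jet_map_gl m (nu : JE E m) (Psi : {linear E (phi m) -> E (phi m)}) :
  Phi m (nu (Adinv (gl Psi))) = Psi (Phi m (nu (Adinv (gl idfun)))).
Proof.
pose Psi' : {linear E m -> E m} := vinv Phi m \o Psi \o Phi m.
have -> : Adinv (gl Psi) = gl Psi'.
  by apply: DE_ext => u; rewrite -[LHS]/(vinv Phi m (Psi (vpush u (phi m)))) vpushE.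
have -> : @Adinv m (gl idfun) = gl idfun.
  by apply: DE_ext => u; rewrite -[LHS]/(vinv Phi m (vpush u (phi m))) vpushE vfibK.
by rewrite (jetP nu).2 /= vinvK.
Qed.

Definition jet_map m (nu : JE E m) : JE E (phi m) :=
  mkJE (jet_map_linear nu) (jet_map_gl nu).

Lemma jet_mapE m u : jet_map (jet m u) = jet (phi m) (vpush u).
Proof. by apply: JE_ext => d; rewrite /= vinvK. Qed.

Definition omni_map m (X : omni E m) : omni E (phi m) := (Ad X.1, jet_map X.2).

(* X' is the section F o X o phi^-1 *)
Definition Frelated (F : forall m, omni E m -> omni E (phi m)) (X X' : Gomni E) :=
  forall m, oval X' (phi m) = F m (oval X m).

(* (F, Phi) is an automorphism of the omni-Lie algebroid.  Smoothness of F and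
   of its inverse is expressed on sections. *)
Record omni_aut (F : forall m, omni E m -> omni E (phi m)) : Prop := OmniAut {
  oaut_linear : forall m, linear (F m);
  oaut_bij : forall m, bijective (F m);
  oaut_smooth : forall X, exists X', Frelated F X X';
  oaut_inv_smooth : forall X', exists X, Frelated F X X';
  oaut_pair : forall m X Y, opair (F m X) (F m Y) = Phi m (opair X Y);
  oaut_bracket : forall X Y Z X' Y' Z',
    Frelated F X X' -> Frelated F Y Y' -> Frelated F Z Z' ->
    is_obracket X Y Z -> is_obracket X' Y' Z';
  oaut_anchor : forall m X, (F m X).1 = Ad X.1
}.

End Automorphisms.

(* Main.v *)
Require Import Defs.
From mathcomp Require Import all_boot all_order all_algebra.
From mathcomp Require Import all_classical all_reals all_analysis.

(** Compatibility with the anchor says that [F (d, mu)] has gauge component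
    [Ad d], so only the jet component of [F] has to be found.

    It is found by pairing.  Pairing [F (0, mu)] with [F (d, 0)], and recalling
    that [Ad] is onto, shows that [F] acts on pure jets by [jet_map]
    ([F_JE]); so [F] is determined by the jet component of [F (d, 0)].  Pulled
    back along [Phi], that component is a jet at [m] depending linearly on [d];
    its value at [e] is the only possible [b d e].  The pairing of [F (d, 0)]
    with [F (e, 0)] vanishes, since [DE] is isotropic, and this is precisely
    the skew-symmetry of [b] ([Bpull_skew]).  Smoothness of [b] holds because
    [F] maps sections to sections.

    Closedness comes from the bracket.  Sections of [DE] form a subalgebra of
    the omni-Lie algebroid, so [F] sends [[D1, D2]] to the bracket of the
    images of [D1] and [D2].  Paired with the image of a third section [D3] and
    transported back by [Phi], the jet component of this identity reads
      b([D1, D2], D3) = D1 b(D2, D3) - b(D2, [D1, D3])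
                        - D2 b(D1, D3) + b(D1, [D2, D3]) + D3 b(D1, D2),
    which is [bd b D1 D2 D3 = 0] up to skew-symmetry ([Bform_closed]). *)

Set Implicit Arguments.
Unset Strict Implicit.
Unset Printing Implicit Defensive.

Import GRing.Theory Num.Theory.
Local Open Scope ring_scope.

Lemma linear_at0 (R : nzRingType) (U V : lmodType R) (f : U -> V) :
  linear f -> f 0 = 0.
Proof.
move=> lf; have := lf 1 0 0; rewrite !scale1r addr0 => /eqP.
by rewrite -subr_eq subrr eq_sym => /eqP.
Qed.

Lemma half_scale_inj (R : numFieldType) (V : lmodType R) (v w : V) :
  2^-1 *: v = 2^-1 *: w -> v = w.
Proof. by apply: (scalerI (a := 2^-1)); rewrite invr_neq0 // pnatr_eq0. Qed.

Section Transport.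
Context {R : realType} {n : nat} {M : manifold R n} {E : vbundle M}.
Variable Phi : vbaut E.
Local Notation phi := (base Phi).

Lemma Ad_is_linear m : linear (@Ad _ _ _ _ Phi m).
Proof. by move=> a d e; apply: DE_ext => u; exact: linearP. Qed.

Lemma Ad_gl m (Psi : {linear E m -> E m}) :
  Ad Phi (gl Psi) = gl (Phi m \o Psi \o vinv Phi m).
Proof. by apply: DE_ext. Qed.

Fact jet_pull_linear m (nu : JE E (phi m)) :
  linear (fun d => vinv Phi m (nu (Ad Phi d))).
Proof. by move=> a d e; rewrite Ad_is_linear (jetP nu).1 linearP. Qed.

Fact jet_pull_gl m (nu : JE E (phi m)) (Psi : {linear E m -> E m}) :
  vinv Phi m (nu (Ad Phi (gl Psi))) =
  Psi (vinv Phi m (nu (Ad Phi (gl idfun)))).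
Proof.
rewrite !Ad_gl (jetP nu).2 [in RHS](jetP nu).2 /=.
by rewrite !vfibK.
Qed.

(** The inverse of [jet_map Phi]. *)
Definition jet_pull m (nu : JE E (phi m)) : JE E m :=
  mkJE (jet_pull_linear nu) (jet_pull_gl nu).

Lemma jet_pullK m (nu : JE E (phi m)) : jet_map Phi (jet_pull nu) = nu.
Proof. by apply: JE_ext => d; rewrite /= vinvK AdinvK. Qed.

Lemma vpush_inj : injective (vpush Phi).
Proof. exact: can_inj (vpull_vpush Phi). Qed.

Lemma vpushB u v : vpush Phi (u - v) = vpush Phi u - vpush Phi v.
Proof.
by rewrite addrC -scaleN1r vpush_linear scaleN1r addrC.
Qed.

Lemma vpushD u v : vpush Phi (u + v) = vpush Phi u + vpush Phi v.
Proof. by have := vpush_linear Phi 1 u v; rewrite !scale1r. Qed.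

(** The action of [Phi] on sections of [DE], as a relation: the sections [D']
    arise as the gauge components of images under [F]. *)
Definition Adrelated (D D' : GDE E) :=
  forall m, gval D' (phi m) = Ad Phi (gval D m).

(** A pointwise relation between values in [DE] amounts to intertwining the two
    derivations, which makes compatibility with commutators formal. *)
Lemma Adrelated_vpush D D' u : Adrelated D D' ->
  D' (vpush Phi u) = vpush Phi (D u).
Proof.
move=> DD'; apply: Gam_ext; apply: (phi_surj (Phi := Phi)) => m.
have /(congr1 (fun d : DE E _ => d (vpush Phi u))) := DD' m.
rewrite /= vpull_vpush => Dm; exact: etrans Dm (esym (vpushE _ _ _)).
Qed.

Lemma Adrelated_bracket D1 D1' D2 D2' :
  Adrelated D1 D1' -> Adrelated D2 D2' ->
  Adrelated (gbracket D1 D2) (gbracket D1' D2').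
Proof.
move=> h1 h2 m; apply: DE_ext => u.
rewrite -[u](vpush_vpull Phi); move: (vpull Phi u) => {}u.
rewrite -[LHS]/(gbr_fun D1' D2' (vpush Phi u) (phi m)).
rewrite /gbr_fun !(Adrelated_vpush _ h1, Adrelated_vpush _ h2) -vpushB vpushE.
by rewrite -[u in LHS](vpull_vpush Phi).
Qed.

End Transport.

Section Decomposition.
Context {R : realType} {n : nat} {M : manifold R n} {E : vbundle M}.
Variables (Phi : vbaut E) (F : forall m, omni E m -> omni E (base Phi m)).
Hypothesis hF : omni_aut F.
Local Notation phi := (base Phi).

(** The contraction of the B-field with [d]: it measures by how much [F] fails
    to preserve [DE]. *)
Definition Bpull m (d : DE E m) : JE E m := jet_pull (F (d, 0)).2.

Lemma FD m (X Y : omni E m) : F (X + Y) = F X + F Y.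
Proof. by have := oaut_linear hF (m := m) 1 X Y; rewrite !scale1r. Qed.

Lemma F_DE m (d : DE E m) : F (d, 0) = (Ad Phi d, jet_map Phi (Bpull d)).
Proof. by rewrite jet_pullK [LHS]surjective_pairing (oaut_anchor hF). Qed.

Lemma Bpull_linear m e : linear (fun d : DE E m => Bpull d e).
Proof.
move=> a d d'; rewrite /Bpull /=.
have -> : (a *: d + d', 0) = a *: (d, 0) + (d', 0) :> omni E m.
  by rewrite -[RHS]/(a *: d + d', a *: 0 + 0 : JE E m) scaler0 addr0.
by rewrite (oaut_linear hF (m := m)) -linearP.
Qed.

(** Elements of [DE] pair to zero, so their images under [F] do as well. *)
Lemma Bpull_skew m (d e : DE E m) : Bpull d e = - Bpull e d.
Proof.
have := oaut_pair hF (d, 0) (e, 0); rewrite !F_DE /opair /= !AdK.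
have -> : (0 : JE E m) d + (0 : JE E m) e = 0 by exact: addr0.
rewrite scaler0 linear0 -linearD -linearZ -(linear0 (Phi m)).
move/(can_inj (vfibK Phi (m := m)))/eqP.
by rewrite scaler_eq0 invr_eq0 pnatr_eq0 /= addrC addr_eq0 => /eqP.
Qed.

Lemma Bpull_alt m (d : DE E m) : Bpull d d = 0.
Proof.
have /eqP := Bpull_skew d d; rewrite -addr_eq0 -mulr2n -scaler_nat.
by rewrite scaler_eq0 pnatr_eq0 => /eqP.
Qed.

Lemma jet_at0 m (nu : JE E m) : nu 0 = 0.
Proof. exact: linear_at0 (jetP nu).1. Qed.

(** Since [Ad] is onto, a jet at [phi m] is determined by its pairings with
    the images under [F] of [DE]. *)
Lemma F_JE m (mu : JE E m) : F (0, mu) = (0, jet_map Phi mu).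
Proof.
have F1 : (F (0, mu)).1 = 0.
  by rewrite (oaut_anchor hF); apply: DE_ext => u; exact: linear0.
rewrite [LHS]surjective_pairing F1; congr pair.
apply: JE_ext => d'; rewrite -[d'](@AdinvK _ _ _ _ Phi); move: (Adinv d') => d.
have := oaut_pair hF (0, mu) (d, 0).
rewrite F_DE /opair F1 !jet_at0 !add0r linearZ => /half_scale_inj->.
by rewrite /= AdK.
Qed.

Lemma omni_aut_decomp m (d : DE E m) (mu : JE E m) :
  F (d, mu) = omni_map Phi (d, mu + Bpull d).
Proof.
have -> : (d, mu) = (0, mu) + (d, 0) :> omni E m.
  by rewrite -[RHS]/(0 + d : DE E m, mu + 0 : JE E m) add0r addr0.
rewrite FD F_JE F_DE.
rewrite -[LHS]/(0 + Ad Phi d, jet_map Phi mu + jet_map Phi (Bpull d)) add0r.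
by congr pair; apply: JE_ext => e; exact: esym (linearD (Phi m) _ _).
Qed.

(** So [(D, jd 0)] is the section [D] of [DE], seen in the omni-Lie
    algebroid. *)
Lemma jd0 m : jd (0 : Gam E) m = 0.
Proof. by apply: JE_ext => d; exact: linear_at0 (gaugeP d).1. Qed.

Lemma Frelated_DE D X' : Frelated F (D, jd 0) X' -> Adrelated Phi D X'.1.
Proof.
move=> hX' m; have := congr1 fst (hX' m).
by rewrite (oaut_anchor hF).
Qed.

Lemma Frelated_DE_pair D X' D2 D2' :
  Frelated F (D, jd 0) X' -> Adrelated Phi D2 D2' ->
  forall m, jpair X'.2 D2' (phi m) = Phi m (Bpull (gval D m) (gval D2 m)).
Proof.
move=> hX' h2 m.
rewrite -[LHS]/((oval X' (phi m)).2 (gval D2' (phi m))) hX' h2.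
have -> : oval (D, jd 0) m = (gval D m, 0) by rewrite -jd0.
by rewrite F_DE /= AdK vinvK.
Qed.

Fact Bpull_smooth D1 D2 :
  is_section (fun m => Bpull (gval D1 m) (gval D2 m)).
Proof.
have [X1 F1] := oaut_smooth hF (D1, jd 0).
have [X2 /Frelated_DE A2] := oaut_smooth hF (D2, jd 0).
have <- : secval (vpull Phi (jpair X1.2 X2.1)) =
    fun m => Bpull (gval D1 m) (gval D2 m).
  apply: dsec_ext => m.
  rewrite -[LHS]/(vinv Phi m (jpair X1.2 X2.1 (phi m))).
  by rewrite (Frelated_DE_pair F1 A2) vfibK.
exact: GamP.
Qed.

Definition Bform : bform E :=
  BForm Bpull_linear Bpull_alt (fun m d => valP (Bpull d)) Bpull_smooth.

Lemma bsec_skew D1 D2 : bsec Bform D1 D2 = - bsec Bform D2 D1.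
Proof. by apply: Gam_ext => m; exact: Bpull_skew. Qed.

Lemma Frelated_DE_bsec D X' D2 D2' :
  Frelated F (D, jd 0) X' -> Adrelated Phi D2 D2' ->
  jpair X'.2 D2' = vpush Phi (bsec Bform D D2).
Proof.
move=> hX' h2; apply: Gam_ext; apply: (phi_surj (Phi := Phi)) => m.
by rewrite (Frelated_DE_pair hX' h2) vpushE.
Qed.

Lemma jpair_jd u (D : GDE E) : jpair (jd u) D = D u.
Proof. by apply: Gam_ext. Qed.

Lemma DE_obracket (D1 D2 : GDE E) :
  is_obracket (D1, jd 0) (D2, jd 0) (gbracket D1 D2, jd 0).
Proof.
have D0 (D : GDE E) : D 0 = 0 by exact: linear_at0 (gop_linear D).
have jp0 D : jpair (jd (0 : Gam E)) D = 0.
  by apply: Gam_ext => m; rewrite -[LHS]/(jd 0 m (gval D m)) jd0.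
by split=> // D; rewrite /lie_pair !jp0 !D0 !subr0 addr0.
Qed.

(** The components of the bracket of [F D1] and [F D2] live over [phi m], the
    cocycle condition over [m]; injectivity of [vpush] carries one to the
    other. *)
Lemma Bform_closed : bclosed Bform.
Proof.
move=> D1 D2 D3.
have [X1 F1] := oaut_smooth hF (D1, jd 0); have A1 := Frelated_DE F1.
have [X2 F2] := oaut_smooth hF (D2, jd 0); have A2 := Frelated_DE F2.
have [X3 F3] := oaut_smooth hF (D3, jd 0); have A3 := Frelated_DE F3.
have [Z FZ] := oaut_smooth hF (gbracket D1 D2, jd 0).
have [_ /(_ X3.1)] := oaut_bracket hF F1 F2 FZ (DE_obracket D1 D2).
rewrite /lie_pair (Frelated_DE_bsec FZ A3) (Frelated_DE_bsec F1 A2).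
rewrite (Frelated_DE_bsec F2 A3) (Frelated_DE_bsec F1 A3).
rewrite (Frelated_DE_bsec F2 (Adrelated_bracket A1 A3)).
rewrite (Frelated_DE_bsec F1 (Adrelated_bracket A2 A3)).
rewrite jpair_jd.
rewrite !(Adrelated_vpush _ A1, Adrelated_vpush _ A2, Adrelated_vpush _ A3).
rewrite -!(vpushB, vpushD) => /vpush_inj bracketE.
rewrite /bd bracketE (bsec_skew D2 (gbracket D1 D3)).
rewrite (bsec_skew D1 (gbracket D2 D3)) !opprK.
move: (bsec _ (gbracket D1 D3) D2) (bsec _ (gbracket D2 D3) D1) => p q.
move: (D1 _) (D2 _) (D3 _) => x y z.
have -> : x + p - (y + q) + z = x - y + z + (p - q).
  by rewrite opprD addrACA [LHS]addrAC.
by rewrite -addrA opprD addNKr addNr.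
Qed.

End Decomposition.

Theorem theorem4p4 (R : realType) (n : nat) (M : manifold R n) (E : vbundle M)
    (Phi : vbaut E) (F : forall m : M, omni E m -> omni E (base Phi m)) :
  omni_aut F ->
  exists b : bform E,
    bclosed b /\
    forall (m : M) (X : omni E m), F m X = omni_map Phi (expb b X).
Proof.
move=> hF; exists (Bform hF); split; first exact: Bform_closed.
move=> m [d mu]; rewrite (omni_aut_decomp hF); congr omni_map; congr pair.
by congr (_ + _); apply: JE_ext.
Qed.
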